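(* Let $\delta,D\ge1$ and $H_D:=\sum_{k=1}^{\lfloor D\rfloor}\frac1k$. Every online algorithm, possibly randomized and even if fractional assignments are permitted, satisfies $$\limsup_{\min_i c_i\to\infty}\ \sup_{I}\ \frac{\mathrm{OPT}(I)}{\mathbb E[\mathrm{ALG}(I)]}\ \ge\ H_D+\ln\delta\ \ge\ \ln(\delta D),$$ where the supremum is over all $I\in\mathcal I(\delta,D,\{c_i\})$, and the same lower bound holds even if the supremum is restricted to instances whose processing durations $d_{ij}$ are all integers. In particular, if an online algorithm is asymptotically $\Gamma$-competitive then $\Gamma\ge H_D+\ln\delta$.
   Context: Model. There are $n$ servers $[n]=\{1,\dots,n\}$; server $i$ has integer capacity $c_i\ge1$. Jobs $1,\dots,m$ are revealed one at a time in index order, with real arrival times $0\le t_1\le\dots\le t_m$ (jobs with equal arrival times are still revealed one after another). $E\subseteq[n]\times[m]$ is the set of compatible pairs and $\mathcal N(j)=\{i:(i,j)\in E\}$. Each $(i,j)\in E$ has a reward rate $r_{ij}>0$ and a duration $d_{ij}>0$. When job $j$ is revealed (with $t_j$, $\mathcal N(j)$ and $(r_{ij},d_{ij})_{i\in\mathcal N(j)}$), the algorithm must irrevocably assign it to one server in $\mathcal N(j)$ or reject it, without knowledge of later jobs or of their number. A job $j$ assigned to $i$ occupies one unit of capacity of $i$ during $[t_j,t_j+d_{ij})$ and yields reward $r_{ij}d_{ij}$; for every server $i$ and time $t\ge0$ at most $c_i$ units may be occupied. Fractional assignments: upon revelation of job $j$ the algorithm irrevocably chooses $x_{ij}\ge0$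 for $i\in\mathcal N(j)$ with $\sum_i x_{ij}\le1$, subject to $\sum_{j:\,t_j\le t<t_j+d_{ij}}x_{ij}\le c_i$ for all $i,t$, and collects $\sum_{i,j}r_{ij}d_{ij}x_{ij}$. $\mathrm{ALG}(I)$ is the total reward collected on instance $I$, with expectation over the algorithm's internal randomness; $\mathrm{OPT}(I)$ is the maximum total reward of a feasible (integral) assignment computed with full knowledge of $I$. Locally bounded reward assumption (parameters $\delta,D\ge1$, known to the algorithm): $1\le d_{ij}\le D$ for all $(i,j)\in E$; and $1/\delta\le r_{ij}/r_{ij'}\le\delta$ whenever $i\in\mathcal N(j)\cap\mathcal N(j')$ and $|t_j-t_{j'}|\le D$. $\mathcal I(\delta,D,\{c_i\})$ is the set of all finite instances satisfying it with server capacities $\{c_i\}_{i\in[n]}$. An online algorithm is asymptotically $\Gamma$-competitive if $\limsup_{\min_i c_i\to\infty}\sup_{I\in\mathcal I(\delta,D,\{c_i\})}\mathrm{OPT}(I)/\mathbb E[\mathrm{ALG}(I)]\le\Gamma$ (instances with $\mathrm{OPT}(I)=0$ are disregarded; the ratio is $+\infty$ if $\mathrm{OPT}(I)>0=\mathbb E[\mathrm{ALG}(I)]$). *)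

(* Defs.v *)
From HB Require Import structures.
From mathcomp Require Import all_boot all_order all_algebra.
From mathcomp Require Import all_classical all_reals all_analysis.

Set Implicit Arguments.
Unset Strict Implicit.
Unset Printing Implicit Defensive.

Import Order.TTheory GRing.Theory Num.Theory.
Import numFieldNormedType.Exports.

Local Open Scope classical_set_scope.
Local Open Scope ring_scope.

Record capacities (n : nat) := Capacities {
  cap :> 'I_n -> nat ;
  cap_ge1 : forall i, (1 <= cap i)%N }.

(* [offer i] is [Some (r, d)] when the job is compatible with server [i], with
   reward rate [r] and duration [d] there, and [None] otherwise: a job carries
   exactly the data that is revealed on its arrival. *)
Record job (R : realType) (n : nat) := Job {
  arrival : R ;
  offer : 'I_n -> option (R * R) }.

Definition compatible (R : realType) (n : nat) (J : job R n) (i : 'I_n) :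
    bool := isSome (offer J i).

(* The values of [rate] and [duration] on incompatible pairs are never used:
   feasible assignments vanish there. *)
Definition rate (R : realType) (n : nat) (J : job R n) (i : 'I_n) : R :=
  if offer J i is Some (r, _) then r else 0.

Definition duration (R : realType) (n : nat) (J : job R n) (i : 'I_n) : R :=
  if offer J i is Some (_, d) then d else 0.

(* The jobs of an instance, in order of revelation. *)
Definition instance (R : realType) (n : nat) := seq (job R n).

Definition nth_job (R : realType) (n : nat) (I : instance R n)
  (j : 'I_(size I)) : job R n := tnth (in_tuple I) j.

Definition well_formed (R : realType) (n : nat) (I : instance R n) : Prop :=
  [/\ forall j : 'I_(size I), 0 <= arrival (nth_job j),
      forall j j' : 'I_(size I), (j <= j')%N ->
        arrival (nth_job j) <= arrival (nth_job j') &
      forall (i : 'I_n) (j : 'I_(size I)), compatible (nth_job j) i ->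
        0 < rate (nth_job j) i /\ 0 < duration (nth_job j) i].

Definition locally_bounded (R : realType) (n : nat) (delta D : R)
    (I : instance R n) : Prop :=
  (forall (i : 'I_n) (j : 'I_(size I)), compatible (nth_job j) i ->
     1 <= duration (nth_job j) i <= D) /\
  (forall (i : 'I_n) (j j' : 'I_(size I)),
     compatible (nth_job j) i -> compatible (nth_job j') i ->
     `|arrival (nth_job j) - arrival (nth_job j')| <= D ->
     delta^-1 <= rate (nth_job j) i / rate (nth_job j') i <= delta).

Definition instances (R : realType) (n : nat) (delta D : R) :
    set (instance R n) :=
  [set I | well_formed I /\ locally_bounded delta D I].

Definition integer_durations (R : realType) (n : nat) : set (instance R n) :=
  [set I | forall (i : 'I_n) (j : 'I_(size I)), compatible (nth_job j) i ->
     duration (nth_job j) i \is a Num.int].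
Arguments integer_durations R n : clear implicits.

Definition feasible (R : realType) (n : nat) (c : capacities n)
    (I : instance R n) (x : 'I_n -> 'I_(size I) -> R) : Prop :=
  [/\ forall i j, 0 <= x i j,
      forall i j, ~~ compatible (nth_job j) i -> x i j = 0,
      forall j, \sum_(i < n) x i j <= 1 &
      forall i (t : R), 0 <= t ->
        \sum_(j < size I | arrival (nth_job j) <= t
                             < arrival (nth_job j) + duration (nth_job j) i)
           x i j <= (c i)%:R].
Arguments feasible {R n} c I x.

Definition reward (R : realType) (n : nat) (I : instance R n)
    (x : 'I_n -> 'I_(size I) -> R) : R :=
  \sum_(i < n) \sum_(j < size I)
    rate (nth_job j) i * duration (nth_job j) i * x i j.
Arguments reward {R n} I x.

(* An integral assignment maps each job to a server or to [None] (rejection);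
   it is identified with the corresponding 0/1-valued fractional assignment. *)
Definition indicator (R : realType) (n m : nat)
    (a : 'I_m -> option 'I_n) : 'I_n -> 'I_m -> R :=
  fun i j => (a j == Some i)%:R.

Definition OPT (R : realType) (n : nat) (c : capacities n)
    (I : instance R n) : R :=
  \big[Order.max/0]_(a : {ffun 'I_(size I) -> option 'I_n}
                     | `[< feasible c I (indicator R a) >])
     reward I (indicator R a).

(* A deterministic online policy maps the sequence of jobs revealed so far, the
   last of which is the current one, to the fractions of the current job given
   to each server; its own earlier decisions are functions of the same data. *)
Definition policy (R : realType) (n : nat) := seq (job R n) -> 'I_n -> R.

Definition run (R : realType) (n : nat) (p : policy R n) (I : instance R n) :
    'I_n -> 'I_(size I) -> R :=
  fun i j => p (take j.+1 I) i.
Arguments run {R n} p I i j.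

(* A randomized fractional online algorithm is a random policy.  Deterministic
   algorithms are those with constant [decide], and integral ones are those
   whose decisions are 0/1-valued. *)
Record online_algorithm (R : realType) (n : nat) (delta D : R)
    (c : capacities n) := OnlineAlgorithm {
  alg_display : measure_display ;
  alg_space : measurableType alg_display ;
  alg_prob : probability alg_space R ;
  decide : alg_space -> policy R n ;
  decide_measurable : forall (h : seq (job R n)) (i : 'I_n),
    measurable_fun setT (fun w => decide w h i) ;
  decide_feasible : forall (w : alg_space) (I : instance R n),
    instances delta D I -> feasible c I (run (decide w) I) }.
Arguments decide {R n delta D c} A w : rename.

Definition expected_reward (R : realType) (n : nat) (delta D : R)
    (c : capacities n) (A : online_algorithm delta D c) (I : instance R n) :
    \bar R :=
  'E_(alg_prob A)[fun w => reward I (run (decide A w) I)].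

(* In [\bar R] the inverse of 0 is [+oo]. *)
Definition worst_ratio (R : realType) (n : nat) (delta D : R)
    (c : capacities n) (A : online_algorithm delta D c)
    (K : set (instance R n)) : \bar R :=
  ereal_sup [set ((OPT c I)%:E / expected_reward A I)%E
            | I in [set I | K I /\ 0 < OPT c I]].

Definition min_capacity_oo (n : nat) : set_system (capacities n) :=
  filter_from setT
    (fun C : nat => [set c : capacities n | forall i, (C <= c i)%N]).
Arguments min_capacity_oo n : clear implicits.

(* An algorithm may depend on the capacities, so it is a family over them.  The
   limit superior is spelled out as in [limf_esup], which only applies to
   functions on a [filteredType]. *)
Definition asymptotic_ratio (R : realType) (n : nat) (delta D : R)
    (A : forall c : capacities n, online_algorithm delta D c)
    (K : set (instance R n)) : \bar R :=
  ereal_inf [set ereal_sup ((fun c => worst_ratio (A c) K) @` V)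
            | V in min_capacity_oo n].

Definition asymptotically_competitive (R : realType) (n : nat) (delta D : R)
    (A : forall c : capacities n, online_algorithm delta D c) (Gamma : R) :
    Prop :=
  (asymptotic_ratio A (instances delta D) <= Gamma%:E)%E.

Definition harmonic_sum (R : realType) (D : R) : R :=
  \sum_(1 <= k < (Num.truncn D).+1) k%:R^-1.

(* Main.v *)
(** A single server of capacity [C] receives, all at time 0, phases of [C]
    identical jobs whose values [v_0 <= v_1 <= ...] first grow as 1, 2, ...,
    floor(D) (durations at rate 1) and then geometrically by [delta] overall
    (rates at duration floor(D)).  All these jobs overlap, so the expected
    amounts [y_k] accepted in phase [k] add up to at most [C].  The instance may
    stop after any phase [m], where OPT is at least [C v_m]; being
    [G]-competitive thus forces [C v_m <= G (v_0 y_0 + ... + v_m y_m)] for all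
    [m].  Summation by parts turns this into
    [G >= sum_k (1 - v_(k-1) / v_k)], whose linear part is the harmonic sum and
    whose geometric part tends to [ln delta]. *)

Require Import Defs.
From HB Require Import structures.
From mathcomp Require Import all_boot all_order all_algebra.
From mathcomp Require Import all_classical all_reals all_analysis.
From mathcomp Require Import measurable_realfun.
From mathcomp Require Import ring lra zify.

Set Implicit Arguments.
Unset Strict Implicit.
Unset Printing Implicit Defensive.

Import Order.TTheory GRing.Theory Num.Theory.
Import numFieldNormedType.Exports.

Local Open Scope classical_set_scope.
Local Open Scope ring_scope.

(** * Summation by parts over the phases *)

(** The value 0 before the first phase makes the first relative increment equal to 1, the leading
    term of the harmonic sum. *)
Definition previous (R : realType) (v : nat -> R) (k : nat) : R :=
  if k is k'.+1 then v k' else 0.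

(* Summation by parts: the slack [G * S_m / v m - C], with [S_m] the weighted
   partial sum, is nonnegative and absorbs the boundary terms. *)
Lemma sum_relative_increments_le (R : realType) (v y : nat -> R) (C G : R)
    (M : nat) :
  0 < C -> 0 <= G ->
  (forall k, (k <= M)%N -> 0 < v k) ->
  (forall k, (k < M)%N -> v k <= v k.+1) ->
  (forall m, (m <= M)%N -> C * v m <= G * \sum_(k < m.+1) v k * y k) ->
  \sum_(k < M.+1) y k <= C ->
  \sum_(k < M.+1) (1 - previous v k / v k) <= G.
Proof.
move=> C0 G0 v0 vS vG yC.
have step m : (m <= M)%N ->
    C * \sum_(k < m.+1) (1 - previous v k / v k)
      + (G * (\sum_(k < m.+1) v k * y k) / v m - C) <= G * \sum_(k < m.+1) y k.
  elim: m => [|m IHm] mM.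
    rewrite !big_ord1 /= mul0r subr0 mulr1 (mulrC (v 0%N)) mulrA mulfK ?gt_eqF ?v0 //.
    lra.
  have vm0 := v0 _ (ltnW mM); have vm1 := v0 _ mM.
  have := IHm (ltnW mM); have := vG _ (ltnW mM); have := vS _ mM.
  rewrite [in X in _ -> _ -> _ -> X]big_ord_recr [in X in _ -> _ -> _ -> X](big_ord_recr m.+1).
  rewrite /= [in X in _ -> _ -> _ -> _ <= X](big_ord_recr m.+1) /=.
  set S := \sum_(k < m.+1) v k * y k; set Y := \sum_(k < m.+1) y k.
  set B := \sum_(k < m.+1) (1 - _) => vmS CS IH.
  have -> : G * (S + v m.+1 * y m.+1) / v m.+1 = G * S / v m.+1 + G * y m.+1.
    by rewrite mulrDr mulrDl; congr (_ + _); field; rewrite gt_eqF.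
  (* The slack at [m] is nonnegative and [1 / v] does not increase from [m] to [m.+1]. The product
     of slack and decrease is exactly what the induction step has to spare. *)
  have key : 0 <= (G * S - C * v m) * ((v m)^-1 - (v m.+1)^-1).
    by rewrite mulr_ge0 ?subr_ge0 // lef_pV2 // posrE.
  have E : (G * S - C * v m) * ((v m)^-1 - (v m.+1)^-1) =
    G * S / v m - G * S / v m.+1 - C + C * (v m / v m.+1).
    by field; rewrite !gt_eqF.
  rewrite {}E in key; move: key IH; clearbody S Y B.
  rewrite !mulrDr mulr1 mulrN.
  move: (G * S / v m) (G * S / v m.+1) (C * (v m / v m.+1)) (C * B).
  move: (G * Y) (G * y m.+1) => *; lra.
have GC : C <= G * (\sum_(k < M.+1) v k * y k) / v M.
  by rewrite ler_pdivlMr ?v0 // vG.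
have GyC := ler_wpM2l G0 yC.
rewrite -(ler_pM2l C0) (mulrC C G).
apply: le_trans GyC; apply: le_trans (step M (leqnn _)).
by rewrite lerDl subr_ge0.
Qed.

(** * The phased instances, their feasible assignments and OPT *)

Definition phase_job (R : realType) (n : nat) (i0 : 'I_n) (r : nat -> R)
    (d : nat -> nat) (k : nat) : job R n :=
  Job 0 (fun i => if i == i0 then Some (r k, (d k)%:R) else None).

(** Job [l] lies in phase [l %/ C]. The cutoff [N] counts jobs rather than phases, so that every
    prefix shown to a policy is again of this form. *)
Definition phases (R : realType) (n : nat) (i0 : 'I_n) (r : nat -> R)
    (d : nat -> nat) (C N : nat) : instance R n :=
  mkseq (fun l => phase_job i0 r d (l %/ C)) N.

Lemma nth_job_phases (R : realType) (n : nat) (i0 : 'I_n) (r : nat -> R)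
    (d : nat -> nat) (C N : nat) (j : 'I_(size (phases i0 r d C N))) :
  nth_job j = phase_job i0 r d (j %/ C).
Proof.
rewrite /nth_job (tnth_nth (phase_job i0 r d 0)) /= nth_mkseq //.
by have := ltn_ord j; rewrite [X in (_ < X)%N]size_mkseq.
Qed.

Lemma take_phases (R : realType) (n : nat) (i0 : 'I_n) (r : nat -> R)
    (d : nat -> nat) (C N l : nat) :
  (l <= N)%N -> take l (phases i0 r d C N) = phases i0 r d C l.
Proof. by move=> lN; rewrite -map_take take_iota (minn_idPl lN). Qed.

Lemma sum_phases (V : nmodType) (R : realType) (n : nat) (i0 : 'I_n)
    (r : nat -> R) (d : nat -> nat) (C N : nat) (F : nat -> V) :
  \sum_(j < size (phases i0 r d C N)) F j = \sum_(0 <= l < N) F l.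
Proof. by rewrite -(big_mkord xpredT) size_mkseq. Qed.

(** All jobs arrive at time 0, so local boundedness compares every pair of them; rates confined to
    [[1, delta]] have all their ratios between [1 / delta] and [delta]. *)
Lemma phases_instances (R : realType) (n : nat) (i0 : 'I_n) (delta D : R)
    (r : nat -> R) (d : nat -> nat) (C M N : nat) :
  (0 < C)%N -> (N <= M * C)%N ->
  (forall k, (k < M)%N -> 1 <= r k <= delta) ->
  (forall k, (k < M)%N -> (0 < d k)%N /\ (d k)%:R <= D) ->
  (instances delta D `&` integer_durations R n) (phases i0 r d C N).
Proof.
move=> C0 NM rP dP.
have jM (j : 'I_(size (phases i0 r d C N))) : (j %/ C < M)%N.
  rewrite ltn_divLR //; apply: leq_trans NM.
  by have := ltn_ord j; rewrite [X in (_ < X)%N]size_mkseq.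
split; [split; [split|split]|].
- by move=> j; rewrite nth_job_phases.
- by move=> j j' _; rewrite !nth_job_phases.
- move=> i j; rewrite !nth_job_phases /compatible /rate /duration /=.
  case: eqP => //= _ _; have [d0 _] := dP _ (jM j).
  by have /andP[r1 _] := rP _ (jM j); rewrite ltr0n d0 (lt_le_trans ltr01 r1).
- move=> i j; rewrite !nth_job_phases /compatible /duration /=.
  by case: eqP => //= _ _; have [d0 dD] := dP _ (jM j); rewrite ler1n d0.
- move=> i j j'; rewrite !nth_job_phases /compatible /rate /=.
  case: eqP => //= _ _ _ _.
  have /andP[r1 rd] := rP _ (jM j); have /andP[r1' rd'] := rP _ (jM j').
  have r0 := lt_le_trans ltr01 r1; have r0' := lt_le_trans ltr01 r1'.
  have delta0 : 0 < delta := lt_le_trans r0 rd.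
  rewrite ler_pdivlMr // ler_pdivrMr // mulrC ler_pdivrMr //.
  apply/andP; split.
    by apply: le_trans rd' _; rewrite ler_peMl // ltW.
  by apply: le_trans rd _; rewrite ler_peMr // ltW.
- move=> i j; rewrite !nth_job_phases /compatible /duration /=.
  by case: eqP => //= _ _; rewrite intr_nat.
Qed.

Lemma reward_run_phases (R : realType) (n : nat) (i0 : 'I_n) (r : nat -> R)
    (d : nat -> nat) (C N : nat) (p : policy R n) :
  reward (phases i0 r d C N) (run p (phases i0 r d C N)) =
  \sum_(0 <= l < N) r (l %/ C)%N * (d (l %/ C)%N)%:R * p (phases i0 r d C l.+1) i0.
Proof.
rewrite /reward (bigD1 i0) //= [X in _ + X]big1 ?addr0 => [|i ii0]; last first.
  apply: big1 => j _.
  by rewrite nth_job_phases /rate /= (negPf ii0) !mul0r.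
rewrite -(@sum_phases R R n i0 r d C N); apply: eq_bigr => j _.
rewrite nth_job_phases /rate /duration /= eqxx /run take_phases //.
by have := ltn_ord j; rewrite [X in (_ < X)%N]size_mkseq.
Qed.

(** Positive durations make every job active at time 0, so the capacity constraint at that single
    time bounds the total amount accepted. *)
Lemma feasible_run_phases (R : realType) (n : nat) (i0 : 'I_n) (r : nat -> R)
    (d : nat -> nat) (C N : nat) (c : capacities n) (p : policy R n) :
  (forall l, (l < N)%N -> (0 < d (l %/ C))%N) ->
  feasible c (phases i0 r d C N) (run p (phases i0 r d C N)) ->
  (forall l, (l < N)%N -> 0 <= p (phases i0 r d C l.+1) i0) /\
  \sum_(0 <= l < N) p (phases i0 r d C l.+1) i0 <= (c i0)%:R.
Proof.
move=> d0 [x0 _ _ xc].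
have ltN (j : 'I_(size (phases i0 r d C N))) : (j < N)%N.
  by have := ltn_ord j; rewrite [X in (_ < X)%N]size_mkseq.
split=> [l lN|].
  have ls : (l < size (phases i0 r d C N))%N by rewrite size_mkseq.
  by have := x0 i0 (Ordinal ls); rewrite /run take_phases.
rewrite -(@sum_phases R R n i0 r d C N); apply: le_trans (xc i0 0 (lexx _)).
rewrite [X in _ <= X]big_mkcond /=; apply: ler_sum => j _.
rewrite nth_job_phases /duration /= eqxx add0r lexx ltr0n d0 ?ltN //=.
by rewrite /run take_phases.
Qed.

Lemma OPT_phases_ge (R : realType) (n : nat) (i0 : 'I_n) (r : nat -> R)
    (d : nat -> nat) (C m : nat) (c : capacities n) :
  (0 < C)%N -> (c i0 = C)%N ->
  C%:R * (r m * (d m)%:R) <= OPT c (phases i0 r d C (m.+1 * C)).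
Proof.
move=> C0 cC; set I := phases _ _ _ _ _.
(* Reject everything before phase [m] and accept its [C] jobs, which exactly fill the server. *)
pose a : {ffun 'I_(size I) -> option 'I_n} :=
  [ffun j : 'I_(size I) => if (m * C <= j)%N then Some i0 else None].
have ind i j : indicator R a i j = ((m * C <= j)%N && (i == i0))%:R.
  by rewrite /indicator ffunE; case: leqP => //= _; rewrite (inj_eq Some_inj) eq_sym.
have block (F : nat -> R) :
    \sum_(0 <= l < m.+1 * C) F l * (m * C <= l)%:R = \sum_(m * C <= l < m.+1 * C) F l.
  rewrite (big_cat_nat (n := (m * C)%N)) //= ?leq_mul2r ?leqnSn ?orbT //.
  rewrite big_nat big1 ?add0r => [|l lm]; last first.
    by rewrite leqNgt; case/andP: lm => _ ->; rewrite mulr0.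
  by rewrite !big_nat; apply: eq_bigr => l /andP[-> _]; rewrite mulr1.
apply: (bigmax_sup a); last first.
  rewrite /reward (bigD1 i0) //= [X in _ + X]big1 ?addr0 => [|i ii0]; last first.
    by apply: big1 => j _; rewrite ind (negPf ii0) andbF mulr0.
  rewrite (eq_bigr (fun j : 'I_(size I) =>
      (r (j %/ C)%N * (d (j %/ C)%N)%:R) * (m * C <= j)%:R)); last first.
    by move=> j _; rewrite ind eqxx andbT nth_job_phases /rate /duration /= eqxx.
  rewrite (@sum_phases R R n i0 r d C (m.+1 * C)
    (fun l => r (l %/ C)%N * (d (l %/ C)%N)%:R * (m * C <= l)%N%:R)).
  rewrite (block (fun l => r (l %/ C)%N * (d (l %/ C)%N)%:R)).
  rewrite big_nat (eq_bigr (fun=> r m * (d m)%:R)); last first.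
    move=> l /andP[lo hi]; have -> // : (l %/ C)%N = m.
    by apply/eqP; rewrite eqn_leq -ltnS ltn_divLR // hi leq_divRL.
  by rewrite -big_nat sumr_const_nat -mulnBl subSnn mul1n mulr_natl.
apply/asboolP; split.
- by move=> i j; rewrite ind ler0n.
- move=> i j; rewrite nth_job_phases /compatible /= ind.
  by case: eqP => //= _; rewrite andbF.
- move=> j; rewrite (bigD1 i0) //= big1 ?addr0 => [|i ii0]; last first.
    by rewrite ind (negPf ii0) andbF.
  by rewrite ind eqxx andbT; case: leqP => _; rewrite ?lexx ?ler01.
- move=> i t _; have [->|ii0] := eqVneq i i0; last first.
    by rewrite big1 ?ler0n // => j _; rewrite ind (negPf ii0) andbF.
  rewrite big_mkcond /=.
  apply: (@le_trans _ _ (\sum_(j < size I) 1 * (m * C <= j)%N%:R)).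
    apply: ler_sum => j _; rewrite ind eqxx andbT mul1r.
    by case: ifP => // _; rewrite ler0n.
  rewrite (@sum_phases R R n i0 r d C (m.+1 * C) (fun l => 1 * (m * C <= l)%N%:R)).
  rewrite (block (fun=> 1)).
  by rewrite sumr_const_nat -mulnBl subSnn mul1n cC.
Qed.

(** * Expected decisions and the bound for a fixed capacity vector *)

(** Linearity of expectation replaces random decisions by their means. The means [q] are fixed
    before [u] and [m], so the same ones serve every stopping phase. *)
Lemma expectation_weighted_sum (R : realType) (disp : measure_display)
    (T : measurableType disp) (P : probability T R) (X : nat -> T -> R)
    (N : nat) (B : R) :
  (forall l, measurable_fun setT (X l)) ->
  (forall l w, (l < N)%N -> 0 <= X l w) ->
  (forall w, \sum_(0 <= l < N) X l w <= B) ->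
  exists q : nat -> R, [/\ forall l, (l < N)%N -> 0 <= q l,
    \sum_(0 <= l < N) q l <= B &
    forall (u : nat -> R) (m : nat), (forall l, (l < N)%N -> 0 <= u l) ->
      (m <= N)%N ->
      'E_P[fun w => (\sum_(0 <= l < m) u l * X l w)%R]%E =
      (\sum_(0 <= l < m) u l * q l)%:E].
Proof.
move=> mX X0 XB.
have cstE (b : R) : (\int[P]_w (cst b%:E) w)%E = b%:E.
  by rewrite integral_cst // [X in (_ * X)%E]probability_setT mule1.
pose q l := fine (\int[P]_w (X l w)%:E)%E.
(* Each [X l] is at most the total, hence at most [B], and the measure has mass 1; the integral is
   thus finite and [fine] loses nothing. *)
have qE l : (l < N)%N -> (\int[P]_w (X l w)%:E)%E = (q l)%:E.
  move=> lN; rewrite fineK // ge0_fin_numE; last first.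
    by apply: integral_ge0 => w _; rewrite lee_fin X0.
  apply: (@le_lt_trans _ _ B%:E); last exact: ltry.
  rewrite -(cstE B); apply: ge0_le_integral => // [w _||w _].
  - by rewrite lee_fin X0.
  - exact/measurable_EFinP.
  rewrite lee_fin; apply: le_trans (XB w).
  rewrite big_mkord (bigD1 (Ordinal lN)) //= lerDl.
  by apply: sumr_ge0 => k _; rewrite X0.
have Eq (u : nat -> R) (m : nat) : (forall l, (l < N)%N -> 0 <= u l) ->
    (m <= N)%N ->
    (\int[P]_w (\sum_(0 <= l < m) u l * X l w)%:E)%E =
    (\sum_(0 <= l < m) u l * q l)%:E.
  move=> u0 mN; have lN (l : 'I_m) : (l < N)%N := leq_trans (ltn_ord l) mN.
  under eq_integral do rewrite big_mkord -sumEFin.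
  rewrite ge0_integral_sum //; last 2 first.
  - by move=> l; apply/measurable_EFinP; apply: measurable_funM.
  - by move=> l w _; rewrite lee_fin mulr_ge0 ?u0 ?X0.
  rewrite big_mkord -sumEFin; apply: eq_bigr => l _.
  rewrite -[LHS]/(\int[P]_w ((u l)%:E * (X l w)%:E))%E.
  rewrite ge0_integralZl_EFin ?u0 ?qE //; last exact/measurable_EFinP.
  by move=> w _; rewrite lee_fin X0.
exists q; split => [l lN||u m u0 mN]; last by rewrite unlock Eq.
  by apply/fine_ge0/integral_ge0 => w _; rewrite lee_fin X0.
rewrite -lee_fin -(cstE B).
have -> : \sum_(0 <= l < N) q l = \sum_(0 <= l < N) 1 * q l.
  by apply: eq_bigr => l _; rewrite mul1r.
rewrite -Eq //.
have one w : \sum_(0 <= l < N) 1 * X l w = \sum_(0 <= l < N) X l w.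
  by apply: eq_bigr => l _; rewrite mul1r.
under eq_integral do rewrite one.
apply: ge0_le_integral => // [w _||w _].
- by rewrite lee_fin big_nat sumr_ge0 // => l /andP[_ lN]; rewrite X0.
- by apply/measurable_EFinP; apply: measurable_sum.
- by rewrite lee_fin.
Qed.

(** The decision on job [l] depends only on the first [l.+1] jobs, so one sequence of expected
    amounts describes the algorithm on all stopped instances at once, and each stopping phase gives
    a linear constraint on it. *)
Lemma worst_ratio_ge (R : realType) (n : nat) (i0 : 'I_n) (delta D : R)
    (c : capacities n) (A : online_algorithm delta D c) (r : nat -> R)
    (d : nat -> nat) (M : nat) (v := fun k => r k * (d k)%:R) :
  (forall k, (k <= M)%N -> 1 <= r k <= delta) ->
  (forall k, (k <= M)%N -> (0 < d k)%N /\ (d k)%:R <= D) ->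
  (forall k, (k < M)%N -> v k <= v k.+1) ->
  ((\sum_(k < M.+1) (1 - previous v k / v k))%:E
     <= worst_ratio A (instances delta D `&` integer_durations R n))%E.
Proof.
move=> rP dP vS; set K := _ `&` _.
set C := cap c i0; have C0 : (0 < C)%N := cap_ge1 c i0.
have CR0 : 0 < C%:R :> R by rewrite ltr0n.
have v0 k : (k <= M)%N -> 0 < v k.
  move=> kM; have [d0 _] := dP _ kM; have /andP[r1 _] := rP _ kM.
  by rewrite mulr_gt0 ?ltr0n // (lt_le_trans ltr01 r1).
have inK N : (N <= M.+1 * C)%N -> K (phases i0 r d C N).
  by move=> NM; apply: (@phases_instances _ _ _ _ _ _ _ _ M.+1).
pose X l w := decide A w (phases i0 r d C l.+1) i0.
have XP w : (forall l, (l < M.+1 * C)%N -> 0 <= X l w) /\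
    \sum_(0 <= l < M.+1 * C) X l w <= C%:R.
  apply: feasible_run_phases; first by move=> l; rewrite -ltn_divLR // => /dP[].
  by apply: decide_feasible; case: (inK _ (leqnn _)).
have [q [q0 qC qE]] := @expectation_weighted_sum R _ _ (alg_prob A) X (M.+1 * C) C%:R
  (fun l => @decide_measurable _ _ _ _ _ A _ i0) (fun l w => (XP w).1 l) (fun w => (XP w).2).
pose y k := \sum_(k * C <= l < k.+1 * C) q l.
have group (u : nat -> R) m :
    \sum_(0 <= l < m * C) u (l %/ C)%N * q l = \sum_(k < m) u k * y k.
  rewrite big_nat_mul big_mkord; apply: eq_bigr => k _.
  rewrite /y mulr_sumr !big_nat; apply: eq_bigr => l /andP[lo hi].
  suff -> : (l %/ C)%N = k by [].
  by apply/eqP; rewrite eqn_leq -ltnS ltn_divLR // hi leq_divRL.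
have rewardE m : (m <= M)%N ->
    expected_reward A (phases i0 r d C (m.+1 * C)) =
    (\sum_(k < m.+1) v k * y k)%:E.
  move=> mM; rewrite -group -qE; last 2 first.
  - by move=> l lM; rewrite ltW // v0 // -ltnS ltn_divLR.
  - by rewrite leq_mul2r ltnS mM orbT.
  rewrite /expected_reward; congr ('E_ _ [ _ ])%E; apply/funext => w.
  by rewrite reward_run_phases.
have S0 m : (m <= M)%N -> 0 <= \sum_(k < m.+1) v k * y k.
  move=> mM; apply: sumr_ge0 => k _.
  have kM : (k <= M)%N := leq_trans (ltn_ord k : (k <= m)%N) mM.
  apply: mulr_ge0; first by rewrite ltW ?v0.
  rewrite /y big_nat sumr_ge0 // => l /andP[_ lk].
  by rewrite q0 // (leq_trans lk) // leq_mul2r ltnS kM orbT.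
have ratio m : (m <= M)%N ->
    ((C%:R * v m)%:E / (\sum_(k < m.+1) v k * y k)%:E <= worst_ratio A K)%E.
  move=> mM; have OPTm := @OPT_phases_ge R n i0 r d C m c C0 erefl.
  apply: le_ereal_sup_tmp; eexists.
    exists (phases i0 r d C (m.+1 * C)); last by [].
    split; first by apply: inK; rewrite leq_mul2r ltnS mM orbT.
    by apply: lt_le_trans OPTm; rewrite mulr_gt0 ?v0.
  rewrite rewardE //; apply: lee_wpmul2r; last by rewrite lee_fin.
  by rewrite inve_ge0 lee_fin S0.
(* The value [+oo] leaves nothing to prove, and [-oo] lies below the nonnegative ratio at phase 0;
   the remaining case is a real [G]. *)
case: (worst_ratio A K) ratio => [G||] ratio; last 2 first.
- by rewrite leey.
- have : (0 <= (C%:R * v 0%N)%:E / (\sum_(k < 1) v k * y k)%:E)%E.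
    by rewrite mule_ge0 ?inve_ge0 // lee_fin ?S0 // mulr_ge0 // ltW ?v0.
  by move/le_trans => /(_ _ (ratio 0%N isT)).
rewrite lee_fin.
(* A zero expected reward would make the ratio [+oo], since 0 has inverse [+oo], against the real
   bound [G]. *)
have Sgt0 m : (m <= M)%N -> 0 < \sum_(k < m.+1) v k * y k.
  move=> mM; rewrite lt_neqAle S0 // andbT eq_sym.
  apply/eqP => S_0; have := ratio m mM.
  by rewrite S_0 inve0 gt0_muley ?leye_eq // lte_fin mulr_gt0 ?v0.
have ratioR m : (m <= M)%N -> C%:R * v m <= G * \sum_(k < m.+1) v k * y k.
  move=> mM; have := ratio m mM.
  by rewrite inver gt_eqF ?Sgt0 // -EFinM lee_fin ler_pdivrMr ?Sgt0.
apply: (@sum_relative_increments_le R v y C%:R G M) => //.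
  have := ratioR 0%N isT; have := Sgt0 0%N isT => S1 CG.
  rewrite -(pmulr_lge0 _ S1); apply: le_trans CG.
  by rewrite mulr_ge0 ?ltW ?v0.
(* Unit weights identify the total of the [y k] with that of the [q l], which is at most [C]. *)
have := group (fun=> 1) M.+1.
under eq_bigr do rewrite mul1r; under [in RHS]eq_bigr do rewrite mul1r.
by move=> <-.
Qed.

(** * Harmonic and geometric increments of the phase values *)

(** With [a = L / N], the claim is [1 - exp (- a) >= a - a ^ 2] taken [N] times; the loss
    [L ^ 2 / N] vanishes as the geometric part is refined. *)
Lemma geometric_increments_ge (R : realType) (L : R) (N : nat) :
  0 <= L -> (0 < N)%N ->
  L - L ^+ 2 / N%:R <= N%:R * (1 - expR (- (L / N%:R))).
Proof.
move=> L0 N0; have NR0 : 0 < N%:R :> R by rewrite ltr0n.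
set a := L / N%:R; have a0 : 0 <= a by rewrite divr_ge0 // ltW.
have -> : L = a * N%:R by rewrite divfK // gt_eqF.
have -> : a * N%:R - (a * N%:R) ^+ 2 / N%:R = N%:R * (a - a ^+ 2).
  by field; rewrite gt_eqF.
rewrite ler_pM2l // expRN.
have ea := expR_ge1Dx a; have e0 := expR_gt0 a.
(* From [exp a >= 1 + a] and [(1 - a + a ^ 2) * (1 + a) = 1 + a ^ 3 >= 1]. *)
have : (expR a)^-1 <= 1 - a + a ^+ 2.
  rewrite -div1r ler_pdivrMr //.
  apply: (@le_trans _ _ ((1 - a + a ^+ 2) * (1 + a))).
    have -> : (1 - a + a ^+ 2) * (1 + a) = 1 + a ^+ 3 by ring.
    by rewrite lerDl exprn_ge0.
  by rewrite ler_wpM2l //; nra.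
lra.
Qed.

(* The truncated subtraction keeps the rate equal to 1 in the first [d]
   phases, where the duration grows. *)
Definition phase_rate (R : realType) (a : R) (d k : nat) : R :=
  expR (a * (k.+1 - d)%:R).

Definition phase_duration (d k : nat) : nat := minn k.+1 d.

(** The first [d] values are 1, ..., [d], with relative increments [1 / k]; from then on each value
    is [exp a] times the one before. *)
Lemma phase_increments (R : realType) (a : R) (d N : nat)
    (v := fun k => phase_rate a d k * (phase_duration d k)%:R) :
  (0 < d)%N ->
  \sum_(0 <= k < d + N) (1 - previous v k / v k) =
  \sum_(1 <= k < d.+1) k%:R^-1 + N%:R * (1 - expR (- a)).
Proof.
move=> d0; rewrite (big_cat_nat (n := d)) //= ?leq_addr //; congr (_ + _).
  rewrite big_add1 /= !big_nat; apply: eq_bigr => k /andP[_ kd].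
  have vE l : (l < d)%N -> v l = l.+1%:R.
    move=> ld; rewrite /v /phase_rate /phase_duration (minn_idPl ld).
    by move: ld; rewrite -subn_eq0 => /eqP ->; rewrite mulr0 expR0 mul1r.
  have -> : previous v k = k%:R by case: k kd => //= k /ltnW/vE.
  rewrite vE // -[X in X - _](@divff _ k.+1%:R) ?pnatr_eq0 // -mulrBl.
  by rewrite -natrB // subSnn div1r.
rewrite -[X in \sum_(X <= _ < _) _]add0n big_addn addKn.
rewrite (eq_bigr (fun=> 1 - expR (- a))).
  by rewrite sumr_const_nat subn0 mulr_natl.
move=> k _; congr (1 - _).
(* This exposes the predecessor. Phase [d.-1] has exponent 0 and duration [d], so the geometric
   pattern covers the step into phase [d] too. *)
have -> : (k + d = (k + d.-1).+1)%N by rewrite -{1}(prednK d0) addnS.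
rewrite /previous /v /phase_rate /phase_duration.
have -> : minn (k + d.-1).+1 d = d by apply/minn_idPr; lia.
have -> : minn (k + d.-1).+2 d = d by apply/minn_idPr; lia.
have -> : ((k + d.-1).+1 - d = k)%N by lia.
have -> : ((k + d.-1).+2 - d = k.+1)%N by lia.
rewrite -mulf_div divff ?mulr1 ?pnatr_eq0 -?lt0n // -expRN -expRD.
by congr expR; rewrite -natr1; ring.
Qed.

(** * From fixed capacities to the limit superior *)

Lemma le_asymptotic_ratio (R : realType) (n : nat) (delta D : R)
    (A : forall c : capacities n, online_algorithm delta D c)
    (K : set (instance R n)) (x : \bar R) :
  (forall c, x <= worst_ratio (A c) K)%E -> (x <= asymptotic_ratio A K)%E.
Proof.
move=> xK; apply: le_ereal_inf_tmp => _ [V [C _ CV] <-].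
(* Any tail of the filter contains a constant vector; the successor keeps it at least 1 even when
   [C] is 0. *)
pose c := @Capacities n (fun=> C.+1) (fun=> isT).
apply: le_ereal_sup_tmp; exists (worst_ratio (A c) K) => //.
by exists c => //; apply: CV => i /=.
Qed.

Lemma worst_ratio_subset (R : realType) (n : nat) (delta D : R)
    (c : capacities n) (A : online_algorithm delta D c)
    (K K' : set (instance R n)) :
  K `<=` K' -> (worst_ratio A K <= worst_ratio A K')%E.
Proof.
move=> KK'; apply: ereal_sup_le => _ [I [KI OPTI] <-].
by exists I => //; split=> //; apply: KK'.
Qed.

(** The bound holds at every capacity vector: the number [N] of geometric phases is independent of
    the phase length, so it can grow while [c] stays fixed. *)
Lemma worst_ratio_ge_harmonic_ln (R : realType) (n : nat) (n_gt0 : (0 < n)%N)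
    (delta D : R) (c : capacities n) (A : online_algorithm delta D c) :
  1 <= delta -> 1 <= D ->
  ((harmonic_sum D + ln delta)%:E
     <= worst_ratio A (instances delta D `&` integer_durations R n))%E.
Proof.
move=> delta1 D1; set K := _ `&` _; set L := ln delta.
have D0 : 0 <= D := le_trans ler01 D1.
have L0 : 0 <= L by apply: ln_ge0.
set d := Num.truncn D; have d0 : (0 < d)%N by rewrite truncn_gt0.
have /andP[dD _] := truncn_itv D0.
have approx N : (0 < N)%N ->
    ((harmonic_sum D + L - L ^+ 2 / N%:R)%:E <= worst_ratio A K)%E.
  move=> N0; set a := L / N%:R.
  have NR0 : 0 < N%:R :> R by rewrite ltr0n.
  have a0 : 0 <= a by rewrite divr_ge0 // ltW.
  have dN : (d + N).-1.+1 = (d + N)%N by rewrite prednK // addn_gt0 d0.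
  pose v k := phase_rate a d k * (phase_duration d k)%:R.
  apply: (@le_trans _ _
    (\sum_(k < (d + N).-1.+1) (1 - previous v k / v k))%:E).
    rewrite lee_fin -(big_mkord xpredT (fun k => 1 - previous v k / v k)) dN.
    by rewrite phase_increments // -addrA lerD2l geometric_increments_ge.
  apply: (@worst_ratio_ge R n (Ordinal n_gt0) delta D c A).
  (* The last phase is [d + N - 1], so exponents reach at most [a * N = ln delta] and rates at most
     [delta]. *)
  - move=> k kdN; rewrite /phase_rate.
    rewrite -{1}expR0 ler_expR mulr_ge0 // -[leRHS](@lnK _ delta) ?posrE ?(lt_le_trans ltr01) //.
    rewrite ler_expR -/L.
    rewrite -[leRHS](@divfK _ N%:R) ?gt_eqF // ler_wpM2l // ler_nat; lia.
  - move=> k _; rewrite /phase_duration leq_min d0 ltnS leq0n; split=> //.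
    by apply: le_trans dD; rewrite ler_nat geq_minr.
  - move=> k _; apply: ler_pM; rewrite ?expR_ge0 ?ler0n //.
      by rewrite ler_expR ler_wpM2l // ler_nat; lia.
    by rewrite ler_nat /phase_duration; lia.
apply/lee_addgt0Pr => e e0.
(* Then [N > L ^ 2 / e], which brings the loss [L ^ 2 / N] below [e]. *)
pose N := (Num.truncn (L ^+ 2 / e)).+1.
have NR0 : 0 < N%:R :> R by rewrite ltr0n.
rewrite -leeBlDr // -EFinB; apply: le_trans (approx N isT).
rewrite lee_fin lerD2l lerN2 ler_pdivrMr // mulrC -ler_pdivrMr //.
by rewrite ltW // truncnS_gt.
Qed.

(** Passing from [ln m.+1] to [ln m.+2] adds [ln (1 + 1 / m.+1) <= 1 / m.+1], so [ln m.+1] is at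
    most the [m]-th harmonic number; with [m] the integer part of [D], [D < m.+1]. *)
Lemma ln_le_harmonic_sum (R : realType) (D : R) :
  1 <= D -> ln D <= harmonic_sum D.
Proof.
move=> D1; have D0 : 0 < D := lt_le_trans ltr01 D1.
have lnS m : ln m.+1%:R <= \sum_(1 <= k < m.+1) (k%:R^-1 : R).
  elim: m => [|m IHm]; first by rewrite ln1 big_nil.
  have m0 : 0 < m.+1%:R :> R by rewrite ltr0n.
  rewrite big_nat_recr //=; apply: le_trans (lerD IHm (lexx _)).
  have -> : m.+2%:R = m.+1%:R * (1 + m.+1%:R^-1) :> R.
    by rewrite mulrDr mulr1 divff ?gt_eqF // natr1.
  have i0 : 0 < m.+1%:R^-1 :> R by rewrite invr_gt0.
  rewrite lnM ?posrE ?addr_gt0 // lerD2l le_ln1Dx //.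
  by rewrite (lt_trans _ i0) // ltrN10.
apply: le_trans (lnS _); rewrite ler_ln ?posrE ?ltr0n //.
by rewrite ltW // truncnS_gt.
Qed.

Theorem theorem2 (R : realType) (n : nat) (n_gt0 : (0 < n)%N)
  (delta D : R) (delta_ge1 : 1 <= delta) (D_ge1 : 1 <= D)
  (A : forall c : capacities n, online_algorithm delta D c) :
  [/\ ((harmonic_sum D + ln delta)%:E
        <= asymptotic_ratio A (instances delta D))%E,
      ((harmonic_sum D + ln delta)%:E
        <= asymptotic_ratio A
             (instances delta D `&` integer_durations R n))%E,
      ln (delta * D) <= harmonic_sum D + ln delta &
      forall Gamma : R, asymptotically_competitive A Gamma ->
        harmonic_sum D + ln delta <= Gamma].
Proof.
have int_case c := @worst_ratio_ge_harmonic_ln R n n_gt0 delta D c (A c)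
  delta_ge1 D_ge1.
have all_case : ((harmonic_sum D + ln delta)%:E
    <= asymptotic_ratio A (instances delta D))%E.
  apply: le_asymptotic_ratio => c; apply: le_trans (int_case c) _.
  by apply: worst_ratio_subset; exact: subIsetl.
split=> //; first exact: le_asymptotic_ratio.
  rewrite lnM ?posrE; [|exact: lt_le_trans delta_ge1|exact: lt_le_trans D_ge1].
  rewrite addrC lerD2r.
  exact: ln_le_harmonic_sum.
by move=> Gamma AG; rewrite -lee_fin; apply: le_trans AG.
Qed.
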